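(* Let $\mathcal G$ be a connected compact metric graph, let $\mathcal V^D\subseteq\mathcal V$ be a nonempty set of degree-one vertices, and let $1<p<\infty$. Then the $p$-torsion function $w_p$ of $\mathcal G$ is positive on $\mathcal G\setminus\mathcal V^D$, i.e. $w_p(x)>0$ for every $x\in\mathcal G\setminus\mathcal V^D$.
   Context: A compact metric graph $\mathcal G$ is obtained from a finite combinatorial graph with vertex set $\mathcal V$ and finite edge set $\mathcal E$ by identifying the endpoints of compact intervals $[0,\ell_e]$, $\ell_e>0$, $e\in\mathcal E$, according to the graph structure; $|\mathcal G|=\sum_{e}\ell_e$. $\mathcal E_v$ is the set of edges incident with $v$ (a loop at $v$ counted twice, once for each endpoint) and $\deg(v)=|\mathcal E_v|$. Set $\mathcal V^N=\mathcal V\setminus\mathcal V^D$. $u_e$ denotes the restriction of $u$ to $e$. $W^{1,p}(\mathcal G)$ is the space of $u:\mathcal G\to\mathbb R$ with $u|_e\in W^{1,p}(0,\ell_e)$ for all $e\in\mathcal E$ and $u$ continuous at every vertex; $W^{1,p}_{\mathcal V^D}(\mathcal G)=\{u\in W^{1,p}(\mathcal G): u(v)=0\ \forall v\in\mathcal V^D\}$. Elements of $W^{1,p}(\mathcal G)$ are identified with their continuous representatives. The $p$-torsion function $w_p$ is the unique function in $W^{1,p}_{\mathcal V^D}(\mathcal G)$ with $-(|w_{p,e}'|^{p-2}w_{p,e}')'=1$ on each edge $e$, $w_p(v)=0$ for $v\in\mathcal V^D$, and $\sum_{e\in\mathcal E_v}|w_{p,e}'(v)|^{p-2}\partial_{\nu_e}w_{p,e}(v)=0$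 for $v\in\mathcal V^N$, where $\partial_{\nu_e}$ is the derivative at $v$ in the outward direction along $e$ (pointing from $v$ into $e$). Equivalently, $\int_{\mathcal G}|w_p'|^{p-2}w_p'\phi'\,dx=\int_{\mathcal G}\phi\,dx$ for all $\phi\in W^{1,p}_{\mathcal V^D}(\mathcal G)$. *)

(* Defs.v *)
From HB Require Import structures.
From mathcomp Require Import all_boot all_order all_algebra.
From mathcomp Require Import all_classical all_reals all_analysis.
Set Implicit Arguments.
Unset Strict Implicit.
Unset Printing Implicit Defensive.
Import Order.TTheory GRing.Theory Num.Theory.
Import numFieldNormedType.Exports.
Local Open Scope classical_set_scope.
Local Open Scope ring_scope.

(* Loops and multiple edges are allowed.  The edge [e] is a copy of the
   interval [0, edge_length e] whose endpoint 0 is glued to the vertex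
   [edge_end e false] and whose endpoint [edge_length e] is glued to
   [edge_end e true]. *)
Record metric_graph (R : realType) := MetricGraph {
  vertex : finType;
  edge : finType;
  edge_end : edge -> bool -> vertex;
  edge_length : edge -> R;
  edge_length_gt0 : forall e, 0 < edge_length e }.

(* A pair (e, b) is an endpoint of e, so a loop at v contributes two
   elements to E_v. *)
Definition half_edges (R : realType) (G : metric_graph R) (v : vertex G)
  : {set edge G * bool} := [set h | edge_end h.1 h.2 == v]%SET.

Definition degree (R : realType) (G : metric_graph R) (v : vertex G) : nat :=
  #|half_edges v|.

Definition adjacent_vertices (R : realType) (G : metric_graph R) : rel (vertex G) :=
  fun u v => [exists e : edge G, exists b : bool,
    (edge_end e b == u) && (edge_end e (~~ b) == v)].

Definition connected_graph (R : realType) (G : metric_graph R) : Prop :=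
  forall u v : vertex G, connect (@adjacent_vertices R G) u v.

Inductive graph_point (R : realType) (G : metric_graph R) : Type :=
  | Vertex of vertex G
  | Interior (e : edge G) of {x : R | 0 < x < edge_length e}.
Arguments Vertex {R G} _.
Arguments Interior {R G} _ _.

(* The quotient map [0, edge_length e] -> G, with junk (constant) values
   outside of [0, edge_length e]. *)
Definition edge_point (R : realType) (G : metric_graph R) (e : edge G) (x : R)
  : graph_point G :=
  if insub x is Some y then Interior e y else Vertex (edge_end e (0 < x)).

Definition edge_restr (R : realType) (G : metric_graph R)
  (u : graph_point G -> R) (e : edge G) : R -> R := fun x => u (edge_point e x).

Definition in_Lp (R : realType) (p l : R) (f : R -> R) : Prop :=
  (f \_ `]0, l[) \in Lfun (@lebesgue_measure R) p%:E.

(* phi belongs to C^1_c(0, l). *)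
Definition test_function (R : realType) (l : R) (phi : R -> R) : Prop :=
  [/\ forall x : R, derivable phi x 1,
      continuous (derive1 phi : R -> R),
      compact (closure [set x | phi x != 0]) &
      closure [set x | phi x != 0] `<=` `]0, l[].

Definition weak_derivative (R : realType) (l : R) (u g : R -> R) : Prop :=
  [/\ locally_integrable `]0, l[ u,
      locally_integrable `]0, l[ g &
      forall phi, test_function l phi ->
        \int[@lebesgue_measure R]_(x in `]0, l[) (u x * derive1 phi x) =
        - \int[@lebesgue_measure R]_(x in `]0, l[) (g x * phi x)].

Definition W1p_interval (R : realType) (p l : R) (u : R -> R) : Prop :=
  in_Lp p l u /\ exists2 g, in_Lp p l g & weak_derivative l u g.

(* Continuous representatives: u is continuous on every closed edge; as the
   value at an endpoint of an edge is the value at the vertex, this includes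
   continuity at the vertices. *)
Definition W1p (R : realType) (p : R) (G : metric_graph R)
  (u : graph_point G -> R) : Prop :=
  forall e : edge G,
    W1p_interval p (edge_length e) (edge_restr u e) /\
    {within `[0, edge_length e], continuous (edge_restr u e)}.

Definition W1p_dirichlet (R : realType) (p : R) (G : metric_graph R)
  (VD : {set vertex G}) (u : graph_point G -> R) : Prop :=
  W1p p u /\ forall v, v \in VD -> u (Vertex v) = 0.

(* |s|^(p-2) s; for s = 0 and p < 2 this is 0, the value of the continuous
   extension. *)
Definition flux (R : realType) (p s : R) : R := `|s| `^ (p - 2) * s.

(* The point of e at distance h from the endpoint b. *)
Definition edge_point_from (R : realType) (G : metric_graph R) (e : edge G)
  (b : bool) (h : R) : graph_point G :=
  edge_point e (if b then edge_length e - h else h).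

Definition outward_derivative (R : realType) (G : metric_graph R)
  (u : graph_point G -> R) (e : edge G) (b : bool) (d : R) : Prop :=
  (u (edge_point_from e b h) - u (Vertex (edge_end e b))) / h @[h --> 0^'+]
    --> d.

(* w' is the weak derivative and the equation on the edges is understood in
   the sense of weak derivatives. *)
Definition edge_equation (R : realType) (p : R) (G : metric_graph R)
  (w : graph_point G -> R) : Prop :=
  forall e : edge G, exists2 g : R -> R,
    weak_derivative (edge_length e) (edge_restr w e) g &
    weak_derivative (edge_length e) (fun x => flux p (g x)) (fun=> -1).

Definition vertex_condition (R : realType) (p : R) (G : metric_graph R)
  (VD : {set vertex G}) (w : graph_point G -> R) : Prop :=
  exists2 d : edge G * bool -> R,
    forall h, outward_derivative w h.1 h.2 (d h) &
    forall v, v \notin VD -> \sum_(h in half_edges v) flux p (d h) = 0.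

Definition is_p_torsion (R : realType) (p : R) (G : metric_graph R)
  (VD : {set vertex G}) (w : graph_point G -> R) : Prop :=
  [/\ W1p_dirichlet p VD w, edge_equation p w & vertex_condition p VD w].

(* Main.v *)
(* On each edge, the du Bois-Reymond lemma gives |w'|^(p-2) w' = c - x, so w'
   is strictly decreasing and w is strictly concave: it is nowhere below the
   smaller of its values at the two endpoints, and strictly above inside the
   edge.  Hence w attains its minimum over G at vertices only.  At a vertex
   where w is minimal all outward derivatives are positive, again by strict
   concavity, which contradicts the vertex condition outside of V^D.  So the
   minimum is 0, attained only on V^D.  The test functions used for the du
   Bois-Reymond lemma are primitives of continuous functions with zero mean. *)

Require Import Defs.
From HB Require Import structures.
From mathcomp Require Import all_boot all_order all_algebra.
From mathcomp Require Import all_classical all_reals all_analysis.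
From mathcomp Require Import measurable_realfun ring lra.
Import Order.TTheory GRing.Theory Num.Theory.
Import numFieldNormedType.Exports.
Local Open Scope classical_set_scope.
Local Open Scope ring_scope.
Set Implicit Arguments.
Unset Strict Implicit.
Unset Printing Implicit Defensive.

Local Notation mu := lebesgue_measure.

(** * Test functions as primitives, and integration by parts *)

Definition supported_inside (R : realType) (l : R) (f : R -> R) : Prop :=
  exists a b : R, [/\ 0 < a, b < l & forall x, x \notin `[a, b] -> f x = 0].

Lemma continuous_integrable_itv (R : realType) (f : R -> R) (a b : R) :
  continuous f -> mu.-integrable `[a, b] (EFin \o f).
Proof.
move=> cf; apply: continuous_compact_integrable; first exact: segment_compact.
exact: continuous_subspaceT.
Qed.

Lemma continuous_bounded_itv (R : realType) (f : R -> R) (a b : R) :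
  continuous f -> [bounded f x | x in `[a, b]].
Proof.
move=> cf; have /compact_bounded : compact (f @` `[a, b]).
  by apply: continuous_compact; [exact: continuous_subspaceT|exact: segment_compact].
move=> [M [Mr HM]]; exists M; split => // x Mx y /= yab.
by apply: (HM x Mx); exists y.
Qed.

Lemma locally_integrable_itv (R : realType) (l a b : R) (f : R -> R) :
  0 < a -> b < l -> locally_integrable `]0, l[ f ->
  mu.-integrable `[a, b] (EFin \o f).
Proof.
move=> a0 bl [mf _ intf].
have sub : `[a, b] `<=` `]0, l[ by apply: subset_itv; rewrite bnd_simp.
apply/integrableP; split.
  by apply/measurable_EFinP; apply: measurable_funS mf.
by apply: intf => //; exact: segment_compact.
Qed.

Lemma restrict_supported (R : realType) (l a b : R) (f g : R -> R) :
  0 < a -> b < l -> (forall x, x \notin `[a, b] -> g x = 0) ->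
  (f \* g) \_ `]0, l[ = (f \* g) \_ `[a, b].
Proof.
move=> a0 bl g0; have sub : `[a, b] `<=` `]0, l[ by apply: subset_itv; rewrite bnd_simp.
apply/funext => x; rewrite /patch !mem_setE.
case: ifPn => xl; case: ifPn => xab //=.
  by rewrite g0 ?mulr0.
by move: xl; rewrite sub.
Qed.

(** Local integrability controls [k] on the compact interval carrying [psi], where [psi] is bounded;
    elsewhere in []0, l[] the product is zero. *)
Lemma integrable_mul_supported (R : realType) (l : R) (k psi : R -> R) :
  locally_integrable `]0, l[ k -> continuous psi -> supported_inside l psi ->
  mu.-integrable `]0, l[ (EFin \o (k \* psi)).
Proof.
move=> lk cpsi [a [b [a0 bl psi0]]].
rewrite integrable_mkcond // restrict_EFin (restrict_supported k a0 bl psi0) -restrict_EFin.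
rewrite -integrable_mkcond //.
have := integrableMl _ (locally_integrable_itv a0 bl lk) _ (continuous_bounded_itv a b cpsi).
apply => //; apply: measurable_funS (continuous_measurable_fun cpsi) => //.
Qed.

(** The primitive vanishes to the left of the support of [psi] because the integrand does, and to
    the right because [psi] has zero mean. *)
Lemma primitive_test_function (R : realType) (l : R) (psi : R -> R) :
  0 < l -> continuous psi -> supported_inside l psi ->
  \int[mu]_(x in `]0, l[) psi x = 0 ->
  exists2 phi, test_function l phi & derive1 phi = psi.
Proof.
move=> l0 cpsi [a [b [a0 bl psi0]]] int0.
(* Starting at [-oo] gives the fundamental theorem of calculus at every real [x], since a test
   function must be derivable on the whole line. *)
pose phi x := \int[mu]_(t in `]-oo, x]) psi t.
have int u : mu.-integrable `]-oo, u] (EFin \o psi).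
  apply: (@integrableS _ _ _ _ setT) => //.
  have : mu.-integrable `[a, b] (EFin \o psi).
    exact: continuous_integrable_itv.
  have epsi : psi \_ `[a, b] = psi.
    by apply/funext => x; rewrite /patch mem_setE; case: ifPn => // /psi0 ->.
  by rewrite [X in X -> _]integrable_mkcond// restrict_EFin epsi.
have der x : derivable phi x 1 /\ phi^`()%classic x = psi x.
  apply: (@continuous_FTC1 _ _ _ _ (x + 1)) => //; first by rewrite ltrDl.
  by rewrite ltNyr.
  exact: cpsi.
have dphi : derive1 phi = psi by apply/funext => x; case: (der x).
have supp x : phi x != 0 -> x \in `[a, b].
  apply: contraNT => xab; apply/eqP; rewrite /phi.
  move: (xab); rewrite in_itv /= negb_and -!ltNge => /orP[xa|bx].
    rewrite (@eq_Rintegral _ _ _ _ _ (cst 0)) ?Rintegral_cst ?mul0r// => y.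
    rewrite mem_setE in_itv /= => yx; apply: psi0.
    by rewrite in_itv /= negb_and -!ltNge (le_lt_trans yx xa).
  (* For [x > b], both []-oo, x]] and []0, l[] contain [[a, b]], so [psi] has the same integral over
     them. *)
  rewrite -int0 [LHS]Rintegral_mkcond [RHS]Rintegral_mkcond; congr (Rintegral _ _ _).
  apply/funext => y; rewrite /patch !mem_setE !in_itv /=.
  case: (boolP (y \in `[a, b])) => [|/psi0 ->]; last by rewrite !if_same.
  rewrite in_itv /= => /andP[ay yb].
  by rewrite (le_trans yb (ltW bx)) (lt_le_trans a0 ay) (le_lt_trans yb bl).
have clo : closure [set x | phi x != 0] `<=` `[a, b].
  rewrite closureE; apply: smallest_sub; first exact: itv_closed.
  by move=> x /supp.
exists phi => //; split.
- by move=> x; case: (der x).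
- by rewrite dphi.
- apply: (subclosed_compact _ (@segment_compact _ a b) clo); exact: closed_closure.
- by apply: subset_trans clo _; apply: subset_itv; rewrite bnd_simp.
Qed.

Lemma test_function_vanishes (R : realType) (l : R) (phi : R -> R) (x : R) :
  test_function l phi -> x \notin `]0, l[ -> phi x = 0.
Proof.
move=> [_ _ _ supp] xl; apply/eqP; apply: contraNT xl => phix.
by apply: supp; exact: subset_closure.
Qed.

Lemma derivable_in_continuous (R : realType) (f : R -> R) (x : R) :
  derivable f x 1 -> {for x, continuous f}.
Proof. by move=> /derivable1_diffP; exact: differentiable_continuous. Qed.

Lemma derivable_in_oo_LRcontinuous (R : realType) (f : R -> R) (a b : R) :
  a <= b -> (forall x, x \in `[a, b] -> derivable f x 1) ->
  derivable_oo_LRcontinuous f a b.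
Proof.
move=> ab df; split.
- by move=> x xab; apply: df; exact: subset_itv_oo_cc.
- apply: cvg_at_right_filter; apply: derivable_in_continuous; apply: df.
  by rewrite in_itv /= lexx.
- apply: cvg_at_left_filter; apply: derivable_in_continuous; apply: df.
  by rewrite in_itv /= lexx andbT.
Qed.

Lemma Rintegral_itv_oo_cc (R : realType) (a b : R) (f : R -> R) :
  {within `[a, b], continuous f} ->
  \int[mu]_(x in `]a, b[) f x = \int[mu]_(x in `[a, b]) f x.
Proof.
move=> cf; have intf : mu.-integrable `[a, b] (EFin \o f).
  by apply: continuous_compact_integrable => //; exact: segment_compact.
rewrite Rintegral_itv_bndo_bndc; last first.
  by apply: integrableS intf => //; apply: subset_itv; rewrite bnd_simp.
by rewrite Rintegral_itv_obnd_cbnd//; apply: integrableS intf => //; apply: subset_itv; rewrite bnd_simp.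
Qed.

(** The boundary terms vanish because [phi] is zero at [0] and at [l]. *)
Lemma integration_by_parts_test_function (R : realType) (l : R) (H h phi : R -> R) :
  0 < l -> (forall x, x \in `[0, l] -> derivable H x 1) ->
  {in `]0, l[, derive1 H =1 h} -> {within `[0, l], continuous h} ->
  test_function l phi ->
  \int[mu]_(x in `]0, l[) (H x * derive1 phi x) =
  - \int[mu]_(x in `]0, l[) (h x * phi x).
Proof.
move=> l0 dH Hh ch tphi; have [dphi cphi _ _] := tphi.
have cH : {within `[0, l], continuous H} by apply: derivable_within_continuous.
have cphi0 : {within `[0, l], continuous phi} by apply: derivable_within_continuous.
have cphi1 : {within `[0, l], continuous (derive1 phi)} by exact: continuous_subspaceT.
rewrite Rintegral_itv_oo_cc; last by move=> x; apply: cvgM; [exact: cH|exact: cphi1].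
rewrite Rintegral_itv_oo_cc; last by move=> x; apply: cvgM; [exact: ch|exact: cphi0].
rewrite (Rintegration_by_parts l0 ch _ Hh cphi1 (G := phi)) //.
- by rewrite !(test_function_vanishes tphi) ?in_itv /= ?ltxx ?andbF // !mulr0 subr0 sub0r.
- by apply: derivable_in_oo_LRcontinuous => //; exact: ltW.
- by apply: derivable_in_oo_LRcontinuous; [exact: ltW|].
Qed.

(** * The du Bois-Reymond lemma, tested against bump functions *)

Lemma continuous_locally_integrable (R : realType) (l : R) (f : R -> R) :
  {within `[0, l], continuous f} -> locally_integrable `]0, l[ f.
Proof.
move=> cf; apply: open_integrable_locally; first exact: interval_open.
have : mu.-integrable `[0, l] (EFin \o f).
  by apply: continuous_compact_integrable => //; exact: segment_compact.
by apply: integrableS => //; exact: subset_itv_oo_cc.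
Qed.

(* Continuous, supported in [a, b], with values in [0, 1], and converging
   pointwise to the indicator of ]a, b[ as n tends to infinity. *)
Definition bump (R : realType) (a b : R) (n : nat) (x : R) : R :=
  let m := Num.max 0 ((x - a) * (b - x)) in m / (m + n.+1%:R^-1).

Lemma bump_den_gt0 (R : realType) (n : nat) (y : R) : 0 < Num.max 0 y + n.+1%:R^-1.
Proof. by rewrite ltr_wpDl// ?le_max ?lexx// invr_gt0. Qed.

Lemma bump_continuous (R : realType) (a b : R) (n : nat) : continuous (bump a b n).
Proof.
have cm : continuous (fun x : R => Num.max 0 ((x - a) * (b - x))).
  move=> x; apply: (@continuous_max _ _ (cst 0) (fun x : R => (x - a) * (b - x))).
    exact: cvg_cst.
  by apply: cvgM; apply: cvgB => //; exact: cvg_cst.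
move=> x; apply: cvgM; first exact: cm.
apply: cvgV; first by rewrite gt_eqF// bump_den_gt0.
by apply: cvgD; [exact: cm|exact: cvg_cst].
Qed.

Lemma bump_out (R : realType) (a b : R) (n : nat) (x : R) :
  a <= b -> x \notin `]a, b[ -> bump a b n x = 0.
Proof.
move=> ab; rewrite in_itv /= negb_and -!leNgt => xab; rewrite /bump /= max_l ?mul0r//.
by case/orP: xab => ?; nra.
Qed.

Lemma bump_norm_le1 (R : realType) (a b : R) (n : nat) (x : R) : `|bump a b n x| <= 1.
Proof.
have den := bump_den_gt0 n ((x - a) * (b - x)).
have num : 0 <= Num.max 0 ((x - a) * (b - x)) by rewrite le_max lexx.
rewrite ger0_norm /bump /= ?divr_ge0 ?(ltW den)//.
by rewrite ler_pdivrMr// mul1r lerDl invr_ge0.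
Qed.

Lemma bump_cvg1 (R : realType) (a b x : R) :
  x \in `]a, b[ -> bump a b n x @[n --> \oo] --> (1 : R).
Proof.
rewrite in_itv /= => /andP[ax xb].
have m0 : 0 < Num.max 0 ((x - a) * (b - x)).
  by rewrite lt_max mulr_gt0 ?subr_gt0 ?orbT.
set m := Num.max _ _ in m0.
rewrite -[X in _ --> X](divff (lt0r_neq0 m0)).
apply: cvgM; first exact: cvg_cst.
apply: cvgV; first by rewrite gt_eqF.
rewrite -[X in _ --> X]addr0; apply: cvgD; first exact: cvg_cst.
exact: cvg_harmonic.
Qed.

(** Dominated convergence with majorant [|k|], as the bumps are bounded by 1 and tend to 1 on []a,
    b[]. *)
Lemma Rintegral_bump_eq0 (R : realType) (a b : R) (k : R -> R) :
  mu.-integrable `]a, b[ (EFin \o k) ->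
  (forall n, \int[mu]_(x in `]a, b[) (k x * bump a b n x) = 0) ->
  \int[mu]_(x in `]a, b[) k x = 0.
Proof.
move=> intk int0; have [mk _] := integrableP _ _ _ intk.
have : (\int[mu]_(x in `]a, b[) (k x * bump a b n x)%:E)%E
    @[n --> \oo] --> (\int[mu]_(x in `]a, b[) k x)%:E.
  rewrite fineK; last exact: integrable_fin_num intk.
  apply: (@dominated_cvg _ _ _ mu `]a, b[ _ (fun n x => (k x * bump a b n x)%:E) (EFin \o k) (fun x => `|k x|%:E)) => //.
  - move=> n; apply/measurable_EFinP; apply: measurable_funM.
      by apply/measurable_EFinP.
    by apply: measurable_funS (continuous_measurable_fun (@bump_continuous _ a b n)).
  - move=> x xab; apply: cvg_EFin; first exact: nearW.
    by rewrite -[X in _ --> X]mulr1; apply: cvgM; [exact: cvg_cst|exact: bump_cvg1].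
  - exact: integrable_norm intk.
  - by move=> n x xab; rewrite /= lee_fin normrM ler_piMr// bump_norm_le1.
move=> /fine_cvg lim; apply: (cvg_unique _ lim) => //.
rewrite (_ : _ \o _ = cst 0); first exact: cvg_cst.
by apply/funext => n; exact: int0.
Qed.

Lemma bump_supported (R : realType) (l a b : R) (n : nat) :
  0 < a -> a < b -> b < l -> supported_inside l (bump a b n).
Proof.
move=> a0 ab bl; exists a, b; split=> // x xab; apply: bump_out; first exact: ltW.
by apply: contra xab; apply: subset_itv_oo_cc.
Qed.

Lemma supported_insideB (R : realType) (l c : R) (f g : R -> R) :
  supported_inside l f -> supported_inside l g ->
  supported_inside l (fun x => f x - c * g x).
Proof.
move=> [a [b [a0 bl f0]]] [a' [b' [a'0 b'l g0]]].
exists (Num.min a a'), (Num.max b b'); split; rewrite ?lt_min ?gt_max ?a0 ?bl//.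
move=> x; rewrite in_itv /= ge_min le_max => xab.
rewrite f0 ?g0 ?mulr0 ?subr0//; apply: contra xab; rewrite in_itv /= => /andP[-> ->];
  by rewrite ?orbT.
Qed.

Lemma Rintegral_mul_bump (R : realType) (l a b : R) (n : nat) (k : R -> R) :
  0 < a -> a < b -> b < l ->
  \int[mu]_(x in `]0, l[) (k x * bump a b n x) =
  \int[mu]_(x in `]a, b[) (k x * bump a b n x).
Proof.
move=> a0 ab bl; rewrite [LHS]Rintegral_mkcond [RHS]Rintegral_mkcond; congr (Rintegral _ _ _).
apply/funext => x; rewrite /patch !mem_setE; case: (boolP (x \in `]a, b[)) => [xab|/(bump_out n (ltW ab))->].
  suff -> : x \in `]0, l[ by [].
  by apply: subset_itv xab; rewrite bnd_simp; exact: ltW.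
by rewrite mulr0 if_same.
Qed.

(** Testing with bumps corrected to zero mean shows that [k - c] is orthogonal to every bump;
    letting the bumps grow to the indicator of []a, b[] gives the claim. *)
Lemma du_bois_reymond_mean (R : realType) (l : R) (k : R -> R) :
  0 < l -> locally_integrable `]0, l[ k ->
  (forall phi, test_function l phi -> supported_inside l (derive1 phi) ->
    \int[mu]_(x in `]0, l[) (k x * derive1 phi x) = 0) ->
  exists c : R, forall a b : R, 0 < a -> a < b -> b < l ->
    \int[mu]_(x in `]a, b[) (k x - c) = 0.
Proof.
move=> l0 lk kphi.
have [a0 [b0 [a00 a0b0 b0l]]] : exists a b : R, [/\ 0 < a, a < b & b < l].
  by exists (l / 3), (l / 2); split; lra.
have int1 psi : continuous psi -> supported_inside l psi ->
    mu.-integrable `]0, l[ (EFin \o psi).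
  move=> cpsi spsi.
  have l1 : locally_integrable `]0, l[ (cst 1 : R -> R).
    by apply: continuous_locally_integrable; apply: continuous_subspaceT => x; exact: cvg_cst.
  have := integrable_mul_supported l1 cpsi spsi.
  by congr (_.-integrable _ (EFin \o _)); apply/funext => x; rewrite /= mul1r.
(* Were all these bumps of integral zero, their limit would force the interval []a0, b0[] to have
   length zero. *)
have [n J0] : exists n, \int[mu]_(x in `]0, l[) bump a0 b0 n x != 0.
  apply: contrapT => /forallNP all0.
  have : \int[mu]_(x in `]a0, b0[) 1 = 0.
    apply: Rintegral_bump_eq0 => [|n].
      apply: integrableS (continuous_integrable_itv a0 b0 (f := cst 1) _) => //.
        exact: subset_itv_oo_cc.
      by move=> x; exact: cvg_cst.
    have /negP := all0 n; rewrite negbK => /eqP <-.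
    by rewrite -(Rintegral_mul_bump n (cst 1) a00 a0b0 b0l); apply: eq_Rintegral => x _; rewrite mul1r.
  have muE : lebesgue_measure (`]a0, b0[ : set R) = (b0 - a0)%:E.
    by rewrite lebesgue_measure_itv /= lte_fin a0b0 -EFinB.
  apply/eqP; rewrite Rintegral_cst// mul1r (_ : fine _ = b0 - a0) ?subr_eq0 ?gt_eqF//.
  exact: congr1 muE.
set psi0 := bump a0 b0 n; set J := Rintegral _ _ _ in J0.
have cpsi0 : continuous psi0 by exact: bump_continuous.
have spsi0 : supported_inside l psi0 by exact: bump_supported.
(* The only possible value: it makes [k - c] orthogonal to [psi0]. *)
pose c := \int[mu]_(x in `]0, l[) (k x * psi0 x) / J.
(* psi - (I / J) psi0 below has zero mean, hence is the derivative of a test function. *)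
exists c => a b a_gt0 ab bl; apply: Rintegral_bump_eq0 => [|m].
  have ik := locally_integrable_itv a_gt0 bl lk.
  have ic : mu.-integrable `[a, b] (EFin \o cst c).
    by apply: continuous_integrable_itv => x; exact: cvg_cst.
  by apply: integrableS (integrableB _ ik ic) => //; exact: subset_itv_oo_cc.
rewrite -(Rintegral_mul_bump m _ a_gt0 ab bl).
set psi := bump a b m.
have cpsi : continuous psi by exact: bump_continuous.
have spsi : supported_inside l psi by exact: bump_supported.
have ipsi := int1 _ cpsi spsi. have ipsi0 := int1 _ cpsi0 spsi0.
have ikpsi := integrable_mul_supported lk cpsi spsi.
have ikpsi0 := integrable_mul_supported lk cpsi0 spsi0.
pose I := \int[mu]_(x in `]0, l[) psi x.
pose chi x := psi x - I / J * psi0 x.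
have cchi : continuous chi.
  by move=> x; apply: cvgB; [exact: cpsi|apply: cvgM; [exact: cvg_cst|exact: cpsi0]].
have chi0 : \int[mu]_(x in `]0, l[) chi x = 0.
  rewrite RintegralB// ?RintegralZl// -/I -/J ?divfK ?subrr//.
  exact: (integrableZl _ (I / J) ipsi0).
have schi : supported_inside l chi by exact: supported_insideB.
have [phi tphi dphi] := primitive_test_function l0 cchi schi chi0.
have := kphi _ tphi; rewrite dphi => /(_ schi).
have -> : (fun x => k x * chi x) = (fun x => k x * psi x - I / J * (k x * psi0 x)).
  by apply/funext => x; rewrite /chi; ring.
rewrite RintegralB// ?RintegralZl//; last exact: (integrableZl _ (I / J) ikpsi0).
move=> E0.
have -> : (fun x => (k x - c) * psi x) = (fun x => k x * psi x - c * psi x).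
  by apply/funext => x; ring.
rewrite RintegralB// ?RintegralZl//; last exact: (integrableZl _ c ipsi).
(* By the choice of [c], [c * I] is [I / J] times the integral of [k * psi0], so the goal is exactly
   [E0]. *)
by rewrite -/I -[RHS]E0 /c; congr (_ - _); ring.
Qed.

(** By Lebesgue differentiation, [k] is almost everywhere the derivative of its primitive, which is
    identically zero on []a, b[]. *)
Lemma ae_eq0_Rintegral_itv (R : realType) (a b : R) (k : R -> R) :
  mu.-integrable `]a, b[ (EFin \o k) ->
  (forall x, x \in `]a, b[ -> \int[mu]_(t in `]a, x[) k t = 0) ->
  {ae mu, forall x, x \in `]a, b[ -> k x = 0}.
Proof.
(* Extending [k] by zero makes it integrable over []a, y]] for every [y], as [FTC1] requires. *)
move=> ik int0; set f := k \_ `]a, b[.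
have iT : mu.-integrable setT (EFin \o f).
  by rewrite /f -restrict_EFin -integrable_mkcond.
have iS y : mu.-integrable `]a, y] (EFin \o f).
  exact: integrableS iT.
have := FTC1 iS (integrable_locally (measurable_itv _) ik).
apply: filterS; first exact: (ae_filter_ringOfSetsType mu).
move=> x /= + xab; move: (xab); rewrite in_itv /= => /andP[ax xb].
rewrite lte_fin => /(_ ax)[_].
rewrite derive1E (near_eq_derive (g := cst 0)) ?derive_cst.
  by rewrite /f /patch mem_setE xab.
near=> y; have : y \in `]a, b[ by near: y; exact: near_in_itvoo.
move=> yab; rewrite -Rintegral_itv_bndo_bndc; last first.
  by apply: integrableS iT.
rewrite -[RHS](int0 y yab); apply: eq_Rintegral => z; rewrite mem_setE => zay.
rewrite /f /patch mem_setE ifT//; apply: subset_itvl zay.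
by move: yab; rewrite in_itv /= => /andP[_ /ltW]; rewrite bnd_simp.
Unshelve. all: by end_near. Qed.

(** As [k] is only locally integrable, the previous lemma is applied on the intervals []a n, l - a
    n[], which exhaust []0, l[]; countably many null sets are discarded. *)
Lemma du_bois_reymond (R : realType) (l : R) (k : R -> R) :
  0 < l -> locally_integrable `]0, l[ k ->
  (forall phi, test_function l phi -> supported_inside l (derive1 phi) ->
    \int[mu]_(x in `]0, l[) (k x * derive1 phi x) = 0) ->
  exists c, {ae mu, forall x, x \in `]0, l[ -> k x = c}.
Proof.
move=> l0 lk /(du_bois_reymond_mean l0 lk)[c kc]; exists c.
pose a n : R := l / 3 * n.+1%:R^-1.
have a_gt0 n : 0 < a n by rewrite mulr_gt0 ?invr_gt0 ?divr_gt0.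
have : forall n, {ae mu, forall x, x \in `]a n, (l - a n)[ -> k x - c = 0}.
  move=> n; apply: (@ae_eq0_Rintegral_itv _ (a n) (l - a n) (fun x => k x - c)).
    have bl : l - a n < l by rewrite gtrBl.
    have ik := locally_integrable_itv (a_gt0 n) bl lk.
    have ic : mu.-integrable `[a n, l - a n] (EFin \o cst c).
      by apply: continuous_integrable_itv => x; exact: cvg_cst.
    by apply: integrableS (integrableB _ ik ic) => //; exact: subset_itv_oo_cc.
  move=> x; rewrite in_itv /= => /andP[ax xl]; apply: kc => //.
  by rewrite (lt_trans xl)// gtrBl.
move=> /ae_foralln; apply: filterS.
move=> x /= kx; rewrite in_itv /= => /andP[x0 xl].
have : a n @[n --> \oo] --> l / 3 * 0 by apply: cvgM; [exact: cvg_cst|exact: cvg_harmonic].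
rewrite mulr0 => /cvgr_lt/(_ (Num.min x (l - x)))[|N _ /(_ N (leqnn N)) /=].
  by rewrite lt_min x0 subr_gt0.
rewrite lt_min => /andP[aNx aNl]; apply/eqP; rewrite -subr_eq0; apply/eqP/(kx N).
by rewrite in_itv /= aNx; lra.
Qed.

(* f - H has weak derivative 0. *)
Lemma weak_derivative_primitive (R : realType) (l : R) (f g h H : R -> R) :
  0 < l -> weak_derivative l f g ->
  {ae mu, forall x, x \in `]0, l[ -> g x = h x} ->
  {within `[0, l], continuous h} ->
  (forall x, x \in `[0, l] -> derivable H x 1) ->
  {in `]0, l[, derive1 H =1 h} ->
  exists c, {ae mu, forall x, x \in `]0, l[ -> f x = H x + c}.
Proof.
move=> l0 [lf lg fg] gh ch dH Hh.
have lH : locally_integrable `]0, l[ H.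
  by apply: continuous_locally_integrable; exact: derivable_within_continuous.
have lh := continuous_locally_integrable ch.
have [|c kc] := du_bois_reymond l0 (locally_integrableB lf lH).
  move=> phi tphi sphi; have [dphi cphi _ _] := tphi.
  have mphi : measurable_fun `]0, l[ phi.
    apply: measurable_funS (continuous_measurable_fun _) => //.
    by move=> x; exact: derivable_in_continuous.
  have -> : (fun x => (f \- H) x * derive1 phi x) =
      (fun x => f x * derive1 phi x - H x * derive1 phi x).
    by apply/funext => x; rewrite /= mulrBl.
  rewrite RintegralB//; last 2 first.
    exact: integrable_mul_supported.
    exact: integrable_mul_supported.
  (* Both pairings with [derive1 phi] have become pairings with [phi], of [g] and of [h]; they
     cancel since [g = h] almost everywhere. *)
  rewrite fg// (integration_by_parts_test_function l0 dH Hh ch tphi) opprK.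
  apply/eqP; rewrite addrC subr_eq0; apply/eqP; congr fine.
  apply: ae_eq_integral => //.
  - by apply/measurable_EFinP; apply: measurable_funM => //; case: lh.
  - by apply/measurable_EFinP; apply: measurable_funM => //; case: lg.
  - apply: filterS gh; first exact: (ae_filter_ringOfSetsType mu).
    by move=> x gx xl; rewrite gx.
exists c; apply: filterS kc; first exact: (ae_filter_ringOfSetsType mu).
move=> x kx /kx <-.
by rewrite /= addrC subrK.
Qed.

(** * The flux [s |-> |s|^(p-2) s] and its inverse *)

Lemma fluxN (R : realType) (p s : R) : flux p (- s) = - flux p s.
Proof. by rewrite /flux normrN mulrN. Qed.

Lemma flux0 (R : realType) (p : R) : flux p 0 = 0.
Proof. by rewrite /flux mulr0. Qed.

Lemma flux_ge0E (R : realType) (p s : R) : 1 < p -> 0 <= s -> flux p s = s `^ (p - 1).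
Proof.
move=> p1 s0; rewrite /flux ger0_norm// mulrC.
by rewrite -(mulr_powRB1 s0 (_ : 0 < p - 1)) ?subr_gt0// -addrA -opprD.
Qed.

Lemma normr_flux (R : realType) (p s : R) : 1 < p -> `|flux p s| = `|s| `^ (p - 1).
Proof.
move=> p1; rewrite -flux_ge0E// /flux normrM normr_id.
by rewrite (ger0_norm (powR_ge0 _ _)).
Qed.

Lemma flux_gt0 (R : realType) (p s : R) : 1 < p -> 0 < s -> 0 < flux p s.
Proof. by move=> p1 s0; rewrite flux_ge0E ?ltW// powR_gt0. Qed.

(** On nonnegative arguments this is the monotonicity of a positive power; oddness reflects it to
    negative ones, and signs settle the mixed case. *)
Lemma flux_lt (R : realType) (p s t : R) : 1 < p -> s < t -> flux p s < flux p t.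
Proof.
move=> p1; have pos u v : 0 <= u -> u < v -> flux p u < flux p v.
  move=> u0 uv; have v0 := ltW (le_lt_trans u0 uv).
  by rewrite !flux_ge0E// gt0_ltr_powR// ?subr_gt0.
move=> st; case: (leP 0 s) => [s0|s0]; first exact: pos.
case: (leP 0 t) => [t0|t0].
  rewrite (@lt_le_trans _ _ 0)//.
    by rewrite -oppr_gt0 -fluxN flux_gt0// oppr_gt0.
  by rewrite flux_ge0E// powR_ge0.
by rewrite -ltrN2 -!fluxN pos// ?ltrN2// oppr_ge0 ltW.
Qed.

Lemma conjugate_gt1 (R : realType) (p : R) : 1 < p -> 1 < p / (p - 1).
Proof. by move=> p1; rewrite ltr_pdivlMr ?subr_gt0// mul1r gtrBl. Qed.

(** For the Hölder conjugate [q = p / (p - 1)] one has [(p - 1) (q - 1) = 1], so the powers cancel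
    on nonnegative arguments; oddness does the rest. *)
Lemma fluxK (R : realType) (p : R) : 1 < p -> cancel (flux p) (flux (p / (p - 1))).
Proof.
move=> p1; have q1 := conjugate_gt1 p1.
have pos s : 0 <= s -> flux (p / (p - 1)) (flux p s) = s.
  move=> s0; rewrite [flux p s]flux_ge0E// flux_ge0E ?powR_ge0// -powRrM.
  rewrite (_ : _ * _ = 1) ?powRr1//; field.
  by rewrite subr_eq0 gt_eqF.
move=> s; case: (leP 0 s) => s0; first exact: pos.
by rewrite -[s]opprK (fluxN p) (fluxN (p / _)) pos// oppr_ge0 ltW.
Qed.

(** Away from 0 this is a product of continuous functions. At 0 the factor [|s|^(p-2)] blows up when
    [p < 2], so the norm [|s|^(p-1)] of the whole product is used. *)
Lemma flux_continuous (R : realType) (p : R) : 1 < p -> continuous (flux p).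
Proof.
move=> p1 s; have [->|s0] := eqVneq s 0.
  rewrite /continuous_at flux0; apply/cvgr0Pnorm_lt => e e0.
  have r0 : 0 < p - 1 by rewrite subr_gt0.
  near=> t; rewrite normr_flux//.
  (* The radius that works for [e] is its power with exponent [1 / (p - 1)]. *)
  have -> : e = (e `^ (p - 1)^-1) `^ (p - 1).
    by rewrite -powRrM mulVf ?gt_eqF// powRr1// ltW.
  rewrite gt0_ltr_powR// ?nnegrE ?powR_ge0//.
  rewrite -[t]subr0 distrC; near: t.
  by apply: (@cvgr_dist_lt _ _ _ (nbhs (0 : R)) _ id) => //; exact: powR_gt0.
apply: cvgM; last exact: cvg_id.
apply: (@continuous_comp _ _ _ (fun t : R => `|t|) (@powR R ^~ (p - 2))); first exact: norm_continuous.
apply: derivable_in_continuous; apply: derivable_powR.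
by rewrite in_itv /= normr_gt0 s0.
Unshelve. all: by end_near. Qed.

(** * Strict concavity of the torsion function on an edge *)

Lemma ae_eq0_within_continuous (R : realType) (l : R) (v : R -> R) :
  0 < l -> {within `[0, l], continuous v} ->
  {ae mu, forall x, x \in `]0, l[ -> v x = 0} ->
  forall x : R, x \in `[0, l] -> v x = 0.
Proof.
move=> l0 cv v0 x xl; apply: contrapT => vx0.
have : v y @[y --> within `[0, l] (nbhs x)] --> v x by have /subspace_continuousP/(_ x) := cv; apply.
move=> /cvgr_neq0 /(_ (introN eqP vx0)).
rewrite near_withinE => -[e /= e0 He].
(* A nonzero value at [x] persists nearby. Clipping the neighbourhood to []0, l[] leaves a nonempty
   interval even if [x] is [0] or [l], and its positive length contradicts [v0]. *)
pose a := Num.max 0 (x - e); pose b := Num.min l (x + e).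
have ab : a < b.
  move: xl; rewrite in_itv /= => /andP[x0 xl].
  by rewrite /a /b gt_max !lt_min; apply/andP; split; apply/andP; split; lra.
have neg : mu.-negligible `]a, b[.
  apply: negligibleS v0 => y; rewrite /= in_itv /= gt_max !lt_min => /andP[/andP[y0 xy] /andP[yl yx]].
  apply/not_implyP; split; first by rewrite in_itv /= y0.
  apply/eqP; apply: He; first by rewrite /= ltr_distlC; apply/andP; split; lra.
  by rewrite in_itv /= !ltW.
have : lebesgue_measure (`]a, b[ : set R) = 0 by exact: measure_negligible neg.
rewrite lebesgue_measure_itv /= lte_fin ab -EFinB => /eqP.
by rewrite eqe subr_eq0 gt_eqF.
Qed.

(** The chord over [[x, b]] is less steep than the chord over [[a, x]], with denominators cleared;
    chords may reach the endpoints [0] and [l]. *)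
Definition strictly_concave (R : realType) (l : R) (u : R -> R) : Prop :=
  forall a x b : R, 0 <= a -> a < x -> x < b -> b <= l ->
    (u b - u x) * (x - a) < (u x - u a) * (b - x).

(** By the mean value theorem the two chord slopes are values of [d], at points on either side of
    [x]. *)
Lemma strictly_concave_derivative (R : realType) (l : R) (u d : R -> R) :
  {within `[0, l], continuous u} ->
  (forall x : R, x \in `]0, l[ -> is_derive x 1 u (d x)) ->
  (forall x y : R, 0 < x -> x < y -> y < l -> d y < d x) ->
  strictly_concave l u.
Proof.
move=> cu du dd a x b a0 ax xb bl.
have slope (s t : R) : 0 <= s -> s < t -> t <= l ->
    exists2 z : R, z \in `]s, t[ & u t - u s = d z * (t - s).
  move=> s0 st tl.
  have dust z : z \in `]s, t[ -> is_derive z 1 u (d z).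
    rewrite in_itv /= => /andP[sz zt]; apply: du.
    by rewrite in_itv /= (le_lt_trans s0 sz) (lt_le_trans zt tl).
  have cust : {within `[s, t], continuous u}.
    by apply: continuous_subspaceW cu; apply: subset_itv; rewrite bnd_simp.
  exact: MVT st dust cust.
have [y + ->] := slope a x a0 ax (le_trans (ltW xb) bl).
have [z + ->] := slope x b (le_trans a0 (ltW ax)) xb bl.
rewrite !in_itv /= => /andP[xz zb] /andP[ay yx].
rewrite -mulrA [X in _ < X]mulrAC -mulrA ltr_pM2r; first by apply: dd; lra.
by rewrite mulr_gt0// subr_gt0.
Qed.

(** Integrating the flux equation and inverting the flux shows that [g] agrees almost everywhere
    with a continuous, strictly decreasing [h]; integrating again identifies [u] with a primitive of
    [h] up to a constant. *)
Lemma torsion_edge_strictly_concave (R : realType) (l p : R) (u g : R -> R) :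
  0 < l -> 1 < p -> {within `[0, l], continuous u} ->
  weak_derivative l u g -> weak_derivative l (fun x => flux p (g x)) (fun=> -1) ->
  strictly_concave l u.
Proof.
move=> l0 p1 cu wu wflux; pose q := p / (p - 1).
have q1 : 1 < q by exact: conjugate_gt1.
have [||||c fc] := @weak_derivative_primitive R l _ _ (cst (-1)) -%R l0 wflux.
- by apply: aeW.
- by apply: continuous_subspaceT => x; exact: cvg_cst.
- by move=> x _.
- by move=> x _; rewrite derive1E deriveN// derive_id.
pose h x := flux q (c - x).
have ch : continuous h.
  move=> x; apply: (@continuous_comp _ _ _ (fun x : R => c - x) (flux q)).
    by apply: cvgB; [exact: cvg_cst|exact: cvg_id].
  exact: flux_continuous.
have gh : {ae mu, forall x, x \in `]0, l[ -> g x = h x}.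
  apply: filterS fc; first exact: (ae_filter_ringOfSetsType mu).
  by move=> x fx xl; rewrite /h addrC -fx// /q fluxK.
(* Starting at -1 makes U differentiable from both sides at 0. *)
pose U (x : R) : R := \int[mu]_(t in `[-1, x]) h t.
have dU (x : R) : x \in `[0, l] -> derivable U x 1 /\ derive1 U x = h x.
  (* The bound [l + 1] leaves room to the right of [l], so that [x = l] is an interior point too. *)
  rewrite in_itv /= => /andP[x0 xl]; apply: (@continuous_FTC1_closed _ _ _ _ (l + 1)).
  - by lra.
  - exact: continuous_integrable_itv.
  - by lra.
  - exact: ch.
have [|||k uk] := @weak_derivative_primitive R l u g h U l0 wu gh.
- exact: continuous_subspaceT.
- by move=> x /dU[].
- by move=> x xl; have /dU[] : x \in `[0, l] by exact: subset_itv_oo_cc.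
(* Continuity upgrades the almost everywhere identity to all of [[0, l]], endpoints included. *)
have uE (x : R) : x \in `[0, l] -> u x = U x + k.
  move=> xl; apply/eqP; rewrite -subr_eq0; apply/eqP.
  apply: (@ae_eq0_within_continuous _ l (fun x => u x - (U x + k))) => //.
    have cU : {within `[0, l], continuous U}.
      by apply: derivable_within_continuous => y /dU[].
    move=> y; apply: cvgB; first exact: cu.
    by apply: cvgD; [exact: cU|exact: cvg_cst].
  apply: filterS uk; first exact: (ae_filter_ringOfSetsType mu).
  by move=> y uy yl; rewrite uy// subrr.
have : strictly_concave l U.
  apply: (@strictly_concave_derivative _ _ _ h).
  - by apply: derivable_within_continuous => y /dU[].
  - move=> x xl; have [dUx <-] : derivable U x 1 /\ derive1 U x = h x.
      by apply: dU; exact: subset_itv_oo_cc.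
    by rewrite derive1E; exact: derivableP.
  - by move=> x y _ xy _; apply: flux_lt => //; rewrite ltrD2l ltrN2.
move=> sU a x b a0 ax xb bl; have := sU a x b a0 ax xb bl.
have [-> -> ->] : [/\ u a = U a + k, u x = U x + k & u b = U b + k].
  by split; apply: uE; rewrite in_itv /=; apply/andP; split; lra.
by rewrite !opprD !(addrACA _ k) subrr !addr0.
Qed.

(** If [u x <= m], the chord from [0] to [x] does not rise and the chord from [x] to [l] does not
    fall, against strict concavity. *)
Lemma strictly_concave_gt_min (R : realType) (l : R) (u : R -> R) (m x : R) :
  strictly_concave l u -> m <= u 0 -> m <= u l -> 0 < x < l -> m < u x.
Proof.
move=> cu m0 ml /andP[x0 xl]; have := cu 0 x l (lexx _) x0 xl (lexx _).
rewrite subr0; case: (ltP m (u x)) => // uxm.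
by rewrite ltNge => /negP[]; rewrite (@le_trans _ _ 0)//;
  [rewrite mulr_le0_ge0|rewrite mulr_ge0]; lra.
Qed.

(** Allows the far end of an edge to be treated as the end [0]. *)
Lemma strictly_concave_rev (R : realType) (l : R) (u : R -> R) :
  strictly_concave l u -> strictly_concave l (fun x => u (l - x)).
Proof.
move=> cu a x b a0 ax xb bl.
have := cu (l - b) (l - x) (l - a).
have -> : l - x - (l - b) = b - x by ring.
have -> : l - a - (l - x) = x - a by ring.
by rewrite subr_ge0 !ltrD2l !ltrN2 gerBl => /(_ bl xb ax a0); lra.
Qed.

(** Difference quotients at [0] dominate the slope of the chord to [l / 2]. The midpoint is used
    because the chord to [l] is flat when [u 0 = u l]. *)
Lemma strictly_concave_right_derivative_gt0 (R : realType) (l : R) (u : R -> R) (d : R) :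
  0 < l -> strictly_concave l u -> u 0 <= u l ->
  (u h - u 0) / h @[h --> 0^'+] --> d -> 0 < d.
Proof.
move=> l0 cu u0l ud.
have um : u 0 < u (l / 2) by apply: (strictly_concave_gt_min cu) => //; lra.
apply: (@lt_le_trans _ _ ((u (l / 2) - u 0) / (l / 2))).
  by rewrite divr_gt0 ?subr_gt0//; lra.
apply: (cvgr_to_ge ud); near=> h.
have h0 : 0 < h by [].
have hl : h < l / 2 by near: h; apply: nbhs_right_lt; lra.
have := cu 0 h (l / 2) (lexx _) h0 hl; rewrite subr0 => c.
rewrite ler_pdivrMr; last lra.
rewrite mulrAC ler_pdivlMr//.
suff : (u (l / 2) - u h) * h < (u h - u 0) * (l / 2 - h) by nra.
by apply: c; lra.
Unshelve. all: by end_near. Qed.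

(** * From the edges to the graph: location of the minimum *)

Lemma edge_point_from0 (R : realType) (G : metric_graph R) (e : edge G) (b : bool) :
  edge_point_from e b 0 = Vertex (edge_end e b).
Proof.
rewrite /edge_point_from /edge_point; case: b; last by rewrite insubF ltxx.
by rewrite subr0 insubF ?ltxx ?andbF// edge_length_gt0.
Qed.

Lemma edge_point_from_length (R : realType) (G : metric_graph R) (e : edge G) (b : bool) :
  edge_point_from e b (edge_length e) = Vertex (edge_end e (~~ b)).
Proof.
rewrite /edge_point_from /edge_point; case: b; first by rewrite subrr insubF ltxx.
by rewrite insubF ?ltxx ?andbF// edge_length_gt0.
Qed.

Lemma Interior_edge_point (R : realType) (G : metric_graph R) (e : edge G)
    (y : {x : R | 0 < x < edge_length e}) :
  Interior e y = edge_point e (val y).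
Proof. by rewrite /edge_point valK. Qed.

(** The first edge of a path from [v] to [v'] starts at [v]. This keeps the sum in the vertex
    condition from being empty. *)
Lemma connected_half_edge (R : realType) (G : metric_graph R) (v v' : vertex G) :
  connected_graph G -> v != v' -> exists h, h \in half_edges v.
Proof.
move=> /(_ v v')/connectP[[|y s] /= + ->]; first by rewrite eqxx.
by move=> /andP[/existsP[e /existsP[b /andP[ev _]]] _] _; exists (e, b); rewrite inE.
Qed.

Lemma torsion_restr_strictly_concave (R : realType) (G : metric_graph R)
    (VD : {set vertex G}) (p : R) (w : graph_point G -> R) (e : edge G) :
  1 < p -> is_p_torsion p VD w -> strictly_concave (edge_length e) (edge_restr w e).
Proof.
move=> p1 [[/(_ e)[_ cw] _] /(_ e)[g wg fg] _].
exact: torsion_edge_strictly_concave (edge_length_gt0 e) p1 cw wg fg.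
Qed.

Lemma torsion_restr_from_strictly_concave (R : realType) (G : metric_graph R)
    (VD : {set vertex G}) (p : R) (w : graph_point G -> R) (e : edge G) (b : bool) :
  1 < p -> is_p_torsion p VD w ->
  strictly_concave (edge_length e) (fun h => w (edge_point_from e b h)).
Proof.
move=> p1 tw; have := torsion_restr_strictly_concave (e := e) p1 tw.
by case: b => //; exact: strictly_concave_rev.
Qed.

(* The outward derivatives at a minimal vertex are positive by strict concavity,
   so that they cannot satisfy the vertex condition. *)
Lemma torsion_vertex_not_min (R : realType) (G : metric_graph R)
    (VD : {set vertex G}) (p : R) (w : graph_point G -> R) (v : vertex G) :
  1 < p -> is_p_torsion p VD w -> v \notin VD ->
  (exists h, h \in half_edges v) ->
  exists v', w (Vertex v') < w (Vertex v).
Proof.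
move=> p1 tw vVD [h0 h0v]; apply: contrapT => /forallNP min.
have [_ _ [d dw /(_ v vVD) sum0]] := tw.
have d_gt0 h : h \in half_edges v -> 0 < flux p (d h).
  case: h => e b; rewrite inE => /eqP /= ev; apply: flux_gt0 => //.
  have := torsion_restr_from_strictly_concave (e := e) b p1 tw.
  move=> /(strictly_concave_right_derivative_gt0 (edge_length_gt0 e)); apply.
    rewrite edge_point_from0 edge_point_from_length ev leNgt; apply/negP.
    exact: min.
  by have := dw (e, b); rewrite /outward_derivative /= edge_point_from0.
move: sum0; rewrite (bigD1 h0) //= => /eqP; apply/negP; rewrite gt_eqF//.
rewrite ltr_pwDl ?d_gt0// sumr_ge0// => h /andP[hv _].
exact/ltW/d_gt0.
Qed.

Theorem proposition3p3 (R : realType) (G : metric_graph R)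
    (VD : {set vertex G}) (p : R) (w : graph_point G -> R)
    (G_connected : connected_graph G)
    (VD_nonempty : VD != finset.set0)
    (VD_degree1 : forall v, v \in VD -> degree v = 1%N)
    (p_gt1 : 1 < p)
    (w_torsion : is_p_torsion p VD w) :
  forall x : graph_point G, x \notin (Vertex @` [set` VD]) -> 0 < w x.
Proof.
have [[_ wVD] _ _] := w_torsion.
have /set0Pn[v0 v0VD] := VD_nonempty.
have lower v : v \notin VD -> exists v', w (Vertex v') < w (Vertex v).
  move=> vVD; have vv0 : v != v0 by apply: contraNneq vVD => ->.
  exact: torsion_vertex_not_min w_torsion vVD (connected_half_edge G_connected vv0).
(* A minimising vertex [m] exists by finiteness; by [lower] it belongs to [VD], where [w]
   vanishes. *)
have vertex_ge0 v : 0 <= w (Vertex v).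
  have [m _ mmin] := arg_minP (fun v => w (Vertex v)) (erefl true : predT v0).
  rewrite (le_trans _ (mmin v _))//.
  have [/wVD->//|/lower[v' v'm]] := boolP (m \in VD).
  by have := lt_le_trans v'm (mmin v' isT); rewrite ltxx.
case=> [v vVD|e y _].
  have [|v'] := lower v; last exact: le_lt_trans.
  by apply: contraNN vVD => vVD; rewrite inE; exists v.
rewrite Interior_edge_point.
apply: (strictly_concave_gt_min (torsion_restr_strictly_concave (e := e) p_gt1 w_torsion)).
- by have := vertex_ge0 (edge_end e false); rewrite -edge_point_from0.
- have := vertex_ge0 (edge_end e true).
  (* Seen from the end [false], the endpoint [true] lies at distance [edge_length e], and
     [edge_point_from e false] computes to [edge_point e]. *)
  by rewrite -[true]/(~~ false) -edge_point_from_length.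
- exact: (valP y).
Qed.
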